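(* Let $q$ be an odd prime power with $q>124$ and let $n=\frac{q+1}{2}$. Then not every element of $\mathbb{F}_q$ is the sum of a $4$-potent and an $n$-potent of $\mathbb{F}_q$; that is, there exists $\gamma\in\mathbb{F}_q$ that cannot be written as $\alpha+\beta$ with $\alpha^n=\alpha$ and $\beta^4=\beta$.
   Context: $\mathbb{F}_q$ denotes the finite field with $q$ elements. For an integer $m>1$, an element $a\in\mathbb{F}_q$ is called an $m$-potent if $a^m=a$. *)

(* Defs.v *)
From mathcomp Require Import all_boot all_order all_algebra all_field.
Set Implicit Arguments. Unset Strict Implicit. Unset Printing Implicit Defensive.
Import GRing.Theory.
Local Open Scope ring_scope.

Definition mpotent (F : ringType) (m : nat) (a : F) : Prop := a ^+ m = a.

(* Main.v *)
(** The n-potents are 0 and the nonzero squares, and the 4-potents are 0 and the cube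
    roots of unity, so the point is to find [x] such that [x - b] is a nonsquare for every
    4-potent [b].  Expanding the product of the [1 - chi (x - b)], the count of such [x] is
    governed by the Legendre sum [S w] (entering three times), where
    [S l := \sum_x chi (x (x - 1) (x - l))] and [w] is a primitive cube root of unity, and
    by a sum attached to [y^2 = x^3 - 1].  If there is no such [x], then [S w] is about
    [q / 3].  Hasse's theorem is not needed to refute this: the second moment of [S] is
    less than [q^2], and [S l ^ 2] takes the value [S w ^ 2] at (in general) twelve points,
    namely the six values of the cross-ratio [w] and, through a 2-isogeny, those of 4;
    hence [12 S(w)^2 < q^2].  Coincidences among the twelve points occur in characteristics
    5, 7 and 13, where [S 4] reduces to a sum with complex multiplication, bounded by its
    own second moment over twists, and in characteristic 37, where a second 2-isogeny
    leads to [l = 9].  When -1 is a nonsquare the sum of [y^2 = x^3 - 1] contributes too,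
    and the prime fields with [q < 1700] are left to a direct search. *)

Require Import Defs.
From mathcomp Require Import all_boot all_order all_algebra all_field.
From mathcomp Require Import zify ring.
From Stdlib Require BinNat Nnat BinPos Pnat.
Set Implicit Arguments. Unset Strict Implicit. Unset Printing Implicit Defensive.
Import Order.TTheory GRing.Theory Num.Theory.
Local Open Scope ring_scope.

(** * Quadratic character *)

Definition cardz (F : finFieldType) : int := #|F|%:Z.

(** Euler's criterion serves as the definition, with integer values so that character sums lie in
    [int]; the link with squares is [card_sqrt]. *)
Definition chi (F : finFieldType) (a : F) : int :=
  if a == 0 then 0 else if a ^+ #|F|.-1./2 == 1 then 1 else -1.

Section QuadraticCharacter.
Variable F : finFieldType.
Hypothesis oddF : odd #|F|.
Implicit Types a b c d x y : F.
Local Notation q := (cardz F).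

Lemma natr2_neq0 : 2%:R != 0 :> F.
Proof.
have [p p_pr charFp] := finPcharP F; rewrite -(dvdn_pcharf charFp) dvdn_prime2 //.
apply: contraTN oddF => /eqP p2; move: charFp; rewrite p2 => charF2.
by rewrite (card_pprimeChar charF2) oddX negb_or /= -lt0n -(ltn_exp2l 0 _ (ltnSn 1))
  -(card_pprimeChar charF2) finNzRing_gt1.
Qed.

Lemma double_half_card : #|F|.-1./2.*2 = #|F|.-1.
Proof. by have := odd_double_half #|F|.-1; have := finNzRing_gt1 F; move: oddF; lia. Qed.

Lemma expf_half_card a : a != 0 -> (a ^+ #|F|.-1./2 == 1) || (a ^+ #|F|.-1./2 == -1).
Proof.
move=> a0; rewrite -subr_eq0 -[X in _ || X]subr_eq0 opprK -mulf_eq0 -subr_sqr expr1n.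
rewrite -exprM muln2 double_half_card subr_eq0 -(inj_eq (mulfI a0)) -exprS.
by rewrite (ltn_predK (finNzRing_gt1 F)) expf_card mulr1.
Qed.

Lemma oner_neqN1 : 1 != -1 :> F.
Proof. by rewrite -subr_eq0 opprK -mulr2n natr2_neq0. Qed.

Lemma chi0 : chi (0 : F) = 0.
Proof. by rewrite /chi eqxx. Qed.

Lemma chi_half a : a != 0 -> (chi a)%:~R = a ^+ #|F|.-1./2.
Proof.
move=> a0; rewrite /chi (negPf a0).
by case/orP: (expf_half_card a0) => /eqP ->; rewrite ?eqxx // eq_sym (negPf oner_neqN1).
Qed.

Lemma chi_cases a : [\/ a = 0 /\ chi a = 0, a != 0 /\ chi a = 1 | a != 0 /\ chi a = -1].
Proof.
rewrite /chi; case: (altP (a =P 0)) => a0; first by constructor 1.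
by case: ifP => _; [constructor 2 | constructor 3].
Qed.

Lemma chi_neq0 a : a != 0 -> chi a = 1 \/ chi a = -1.
Proof. by rewrite /chi => /negPf ->; case: ifP; [left | right]. Qed.

Lemma chiM a b : chi (a * b) = chi a * chi b.
Proof.
have [->|a0] := eqVneq a 0; first by rewrite mul0r chi0 mul0r.
have [->|b0] := eqVneq b 0; first by rewrite mulr0 chi0 mulr0.
have := chi_half (mulf_neq0 a0 b0); rewrite exprMn -!chi_half // -intrM => /eqP.
have N11 : (1 == -1 :> F) = false by apply/negbTE/oner_neqN1.
have N11' : (-1 == 1 :> F) = false by rewrite eq_sym.
by case: (chi_neq0 a0) => ->; case: (chi_neq0 b0) => ->; case: (chi_neq0 (mulf_neq0 a0 b0)) => ->;
  rewrite ?mulrNN ?mulr1 ?mul1r ?mulrN1 ?rmorphN ?N11 ?N11'.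
Qed.

Lemma chi1 : chi (1 : F) = 1.
Proof. by rewrite /chi oner_eq0 expr1n eqxx. Qed.

Lemma chi_sqr a : a != 0 -> chi (a ^+ 2) = 1.
Proof.
by move=> a0; rewrite expr2 chiM; case: (chi_neq0 a0) => ->.
Qed.

Lemma chi_Msqr a b : b != 0 -> chi (a * b ^+ 2) = chi a.
Proof. by move=> b0; rewrite chiM chi_sqr // mulr1. Qed.

Lemma chi_sqr1 a : a != 0 -> chi a * chi a = 1.
Proof. by move=> a0; rewrite -chiM -expr2 chi_sqr. Qed.

(** Otherwise all q - 1 nonzero elements would be roots of X^((q-1)/2) - 1. *)
Lemma exists_nonsquare : exists a : F, chi a = -1.
Proof.
suff /existsP[a /eqP] : [exists a : F, chi a == -1] by exists a.
apply: contraT; rewrite negb_exists => /forallP noN.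
have := @max_unity_roots F #|F|.-1./2 [seq x <- enum F | x != 0].
have dbl := double_half_card; have F1 : (1 < #|F|)%N := finNzRing_gt1 F.
move=> bound; suff: (#|F|.-1 <= #|F|.-1./2)%N.
  by move=> le_half; move: F1 dbl le_half; rewrite -muln2; lia.
apply: leq_trans (bound _ _ _); first 1 last.
- by lia.
- apply/allP => x; rewrite mem_filter => /andP[x0 _]; apply/unity_rootP.
  by rewrite -chi_half //; move: (noN x); case: (chi_neq0 x0) => ->.
- by rewrite filter_uniq ?enum_uniq.
rewrite -(cardC1 (0 : F)) cardE /enum_mem size_filter size_filter count_filter.
by apply/eq_leq/eq_count => x; rewrite /= !inE andbT.

Qed.

(** Scaling by a nonsquare reverses the sign of the sum. *)
Lemma sum_chi : \sum_x chi (x : F) = 0.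
Proof.
have [a ca] := exists_nonsquare.
have a0 : a != 0 by apply: contra_eq_neq ca => ->; rewrite chi0.
have : \sum_x chi (x : F) = - \sum_x chi (x : F); last by lia.
rewrite [LHS](reindex_inj (mulfI a0)) /= -mulN1r mulr_sumr.
by apply: eq_bigr => x _; rewrite chiM ca.
Qed.

Lemma sum_one : \sum_(x : F) 1 = q.
Proof. by rewrite sumr_const natz. Qed.

(** The inequality [<=] is clear for each [a], and both sides total q over all [a], so equality
    holds throughout. *)
Lemma card_sqrt a : \sum_(x : F | x ^+ 2 == a) 1 = 1 + chi a.
Proof.
pose r a : int := \sum_(x : F | x ^+ 2 == a) 1.
have r_le b : r b <= 1 + chi b.
  rewrite /r; case: (pickP (fun x : F => x ^+ 2 == b)) => [x /eqP xb|none]; last first.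
    by rewrite big_pred0 //; case: (chi_cases b) => [] [] _ ->.
  have [x0|x0] := eqVneq x 0.
    rewrite (big_pred1 (0 : F)); first by rewrite -xb x0 expr0n chi0.
    by move=> y; rewrite -xb x0 expr0n sqrf_eq0.
  rewrite (bigD1 x) ?xb //= (bigD1 (- x)) /=; last first.
    rewrite sqrrN xb eqxx -subr_eq0 -opprD oppr_eq0 -mulr2n -mulr_natl mulf_eq0.
    by rewrite negb_or natr2_neq0.
  rewrite big_pred0; first by rewrite -xb chi_sqr.
  by move=> y; rewrite -xb eqf_sqr; do 2!case: eqP => //.
have tot : \sum_b (1 + chi b - r b) = 0.
  rewrite sumrB big_split /= sum_chi sum_one /r (exchange_big_dep xpredT) //=.
  rewrite (eq_bigr (fun=> 1)) ?sum_one ?addr0 ?subrr // => x _.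
  by rewrite (big_pred1 (x ^+ 2)) // => b; rewrite eq_sym.
apply/esym/eqP; rewrite -subr_eq0; apply/eqP.
by apply: (psumr_eq0P _ tot) => // b _; rewrite subr_ge0.
Qed.

End QuadraticCharacter.

(** * Character sums and their second moments *)

(** Minus the Frobenius trace of the Legendre curve, when [l] is neither 0 nor 1. The next two sums
    belong in the same way to the curves of j-invariant 0 and 1728. *)
Definition legendre_sum (F : finFieldType) (l : F) : int :=
  \sum_(x : F) chi (x * (x - 1) * (x - l)).

Definition cubic_sum (F : finFieldType) (c : F) : int := \sum_(x : F) chi (x ^+ 3 - c).

Definition lemniscate_sum (F : finFieldType) (d : F) : int := \sum_(x : F) chi (x ^+ 3 - d * x).

Section CharacterSums.
Variable F : finFieldType.
Hypothesis oddF : odd #|F|.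
Implicit Types a b c d l x y : F.
Local Notation q := (cardz F).

Lemma cardz_ge0 : 0 <= q.
Proof. by []. Qed.

Lemma sum_neq0 (G : F -> int) : \sum_(x | x != 0) G x = (\sum_(x : F) G x) - G 0.
Proof. by rewrite [\sum_(x : F) G x](bigD1 0) //= [G 0 + _]addrC addrK. Qed.

Lemma card_quadratic a b : \sum_(x | x ^+ 2 - a * x + b == 0) 1 = 1 + chi (a ^+ 2 - 4%:R * b).
Proof.
have two0 := natr2_neq0 oddF.
have inj_h : injective (fun x => 2%:R * x - a) by move=> x y /addIr /(mulfI two0).
rewrite -card_sqrt // [RHS](reindex_inj inj_h) /=; apply: eq_bigl => x.
rewrite -[RHS]subr_eq0 [in RHS](_ : _ - _ = (2%:R * 2%:R) * (x ^+ 2 - a * x + b)); last by ring.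
by rewrite !mulf_eq0 (negPf two0).
Qed.

(** After a shift, dividing by the square x^2 leaves [1 + (a - b) / x], which for [a != b] takes
    every value except 1 once. *)
Lemma sum_chi_pair a b : \sum_(x : F) chi ((x - a) * (x - b)) = (if a == b then q else 0) - 1.
Proof.
rewrite (reindex_inj (addIr a)) /=.
have -> : \sum_(x : F) chi ((x + a - a) * (x + a - b)) = \sum_(x | x != 0) chi (1 + (a - b) / x).
  rewrite (bigD1 0) //= add0r subrr mul0r chi0 add0r.
  apply: eq_bigr => x x0; rewrite -[RHS](chi_Msqr oddF _ x0); congr chi; field.
  by [].
have [->|ab] := eqVneq a b.
  rewrite (eq_bigr (fun=> 1)) => [|x _]; last by rewrite subrr mul0r addr0 chi1.
  by rewrite sum_neq0 sum_one.
(* Since [0^-1 = 0], restoring the term at 0, which is [chi 1], makes the argument run over all of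
   [F]. *)
rewrite sum_neq0 invr0 mulr0 addr0 chi1; congr (_ - _).
have inj_h : injective (fun x => 1 + (a - b) / x).
  by move=> x y /addrI; move: ab; rewrite -subr_eq0 => ab /(mulfI ab)/invr_inj.
by rewrite -[RHS](sum_chi oddF) [RHS](reindex_inj inj_h).
Qed.

(** Expand the square and sum over [d] first: by [sum_chi_pair] a pair with [h x = h y] gets weight
    q - 1, any other pair -1. *)
Lemma chi_family_moment2 (g : F -> int) (h : F -> F) :
  \sum_(d : F) (\sum_(x : F) g x * chi (h x - d)) ^+ 2 =
  q * (\sum_(x : F) \sum_(y | h y == h x) g x * g y) - (\sum_(x : F) g x) ^+ 2.
Proof.
have -> : \sum_(d : F) (\sum_(x : F) g x * chi (h x - d)) ^+ 2 =
    \sum_(x : F) \sum_(y : F) g x * g y * \sum_(d : F) chi ((d - h x) * (d - h y)).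
  under eq_bigr do rewrite expr2 mulr_suml; rewrite exchange_big /=.
  apply: eq_bigr => x _; under eq_bigr do rewrite mulr_sumr; rewrite exchange_big /=.
  apply: eq_bigr => y _; rewrite mulr_sumr; apply: eq_bigr => d _.
  by rewrite mulrACA -chiM //; congr (_ * chi _); ring.
rewrite expr2 mulr_suml mulr_sumr -sumrB; apply: eq_bigr => x _.
rewrite !mulr_sumr [in X in X - _]big_mkcond /= -sumrB; apply: eq_bigr => y _.
rewrite sum_chi_pair eq_sym; case: eqP => _; ring.
Qed.

Lemma legendre_moment2 : \sum_(l : F) legendre_sum l ^+ 2 = q ^+ 2 - 2 * q - 1 :> int.
Proof.
rewrite (eq_bigr (fun l : F => (\sum_(x : F) chi (x * (x - 1)) * chi (id x - l)) ^+ 2)); last first.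
  by move=> l _; congr (_ ^+ 2); apply: eq_bigr => x _; rewrite -chiM.
rewrite chi_family_moment2.
have -> : \sum_(x : F) chi (x * (x - 1)) = -1 :> int.
  rewrite (eq_bigr (fun x => chi ((x - 0) * (x - 1)))) => [|x _]; last by rewrite subr0.
  by rewrite sum_chi_pair eq_sym oner_eq0.
have -> : \sum_(x : F) \sum_(y | y == x) chi (x * (x - 1)) * chi (y * (y - 1)) = q - 2 :> int.
  under eq_bigr do rewrite big_pred1_eq.
  rewrite (bigD1 0) //= (bigD1 1) ?oner_eq0 //= subrr mul0r mulr0 chi0 mulr0 !add0r.
  rewrite (eq_bigr (fun=> 1)); last first.
    by move=> x /andP[x0 x1]; rewrite chi_sqr1 // mulf_neq0 // subr_eq0.
  rewrite -sum_one [in RHS](bigD1 0) //= [in RHS](bigD1 1) ?oner_eq0 //=.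
  by rewrite [RHS]addrC !addrA; lia.
by ring.
Qed.

(** * Bounds from second moments over twists *)

Lemma card_roots_le m c : (0 < m)%N -> \sum_(x : F | x ^+ m == c) 1 <= m%:Z.
Proof.
move=> m0; rewrite sumr_const.
have := @max_poly_roots F ('X^m - c%:P) (enum [pred x | x ^+ m == c]).
rewrite size_XnsubC // ltnS -cardE => bound; rewrite -[1 *+ _]/(_%:R).
rewrite natz lez_nat; apply: bound; last exact: enum_uniq.
  by rewrite -size_poly_eq0 size_XnsubC.
by apply/allP => x; rewrite mem_enum inE => /eqP xc; rewrite rootE !hornerE xc subrr.
Qed.

Lemma sum_fibers_le (g : F -> int) m : (0 < m)%N -> (forall x, `|g x| <= 1) ->
  \sum_(x : F) \sum_(y | y ^+ m == x ^+ m) g x * g y <= m%:Z * q.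
Proof.
move=> m0 g1; rewrite -sum_one // mulr_sumr; apply: ler_sum => x _; rewrite mulr1.
apply: le_trans (card_roots_le (x ^+ m) m0); apply: ler_sum => y _.
by have := g1 x; have := g1 y; nia.
Qed.

(** The q - 1 values at m-th powers of nonzero [k] have equal squares, and each [c] is an m-th power
    in at most [m] ways. *)
Lemma power_twist_bound (G : F -> int) m : (0 < m)%N ->
  (forall k, k != 0 -> G (k ^+ m) ^+ 2 = G 1 ^+ 2) ->
  (q - 1) * G 1 ^+ 2 <= m%:Z * \sum_(c : F) G c ^+ 2.
Proof.
move=> m0 twist.
have -> : (q - 1) * G 1 ^+ 2 = \sum_(k | k != 0) G (k ^+ m) ^+ 2.
  rewrite (eq_bigr (fun=> 1 * G 1 ^+ 2)) => [|k /twist]; last by rewrite mul1r.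
  by rewrite -mulr_suml sum_neq0 sum_one.
apply: le_trans (_ : \sum_k G (k ^+ m) ^+ 2 <= _).
  by rewrite sum_neq0 lerBlDr lerDl sqr_ge0.
rewrite (partition_big (fun k => k ^+ m) xpredT) //= mulr_sumr.
apply: ler_sum => c _.
rewrite (eq_bigr (fun=> 1 * G c ^+ 2)) => [|k /eqP ->]; last by rewrite mul1r.
by rewrite -mulr_suml ler_wpM2r ?sqr_ge0 ?card_roots_le.
Qed.

(** Scaling [x] by [j] changes the sum only by the sign [chi j]. The moment over all [c] is at most
    3q^2 - q^2, and the twist bound multiplies it by 3. *)
Lemma cubic_sum_bound (k : F) : k != 0 -> (q - 1) * cubic_sum (k ^+ 3) ^+ 2 <= 6 * q ^+ 2.
Proof.
have twist (j : F) : j != 0 -> cubic_sum (j ^+ 3) ^+ 2 = cubic_sum (1 : F) ^+ 2.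
  move=> j0; rewrite -[RHS]mul1r -(chi_sqr1 oddF j0) -expr2 -exprMn; congr (_ ^+ 2).
  rewrite /cubic_sum (reindex_inj (mulfI j0)) /= mulr_sumr; apply: eq_bigr => x _.
  by rewrite -chiM // -[RHS](chi_Msqr oddF _ j0); congr chi; ring.
move=> /twist ->; apply: le_trans (power_twist_bound _ twist) _ => //.
have -> : \sum_(c : F) cubic_sum c ^+ 2 =
    q * (\sum_(x : F) \sum_(y | y ^+ 3 == x ^+ 3) 1 * 1) - q ^+ 2 :> int.
  have /= := chi_family_moment2 (fun=> 1) (fun x => x ^+ 3); rewrite sum_one => <-.
  by apply: eq_bigr => c _; congr (_ ^+ 2); apply: eq_bigr => x _; rewrite mul1r.
have := cardz_ge0; have := @sum_fibers_le (fun=> 1) 3 isT (fun=> lexx _); nia.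
Qed.

(** As before, with x^3 - d x = x (x^2 - d): the weight [chi x] has sum 0, the moment is at most
    2q^2, and the twist bound doubles it. *)
Lemma lemniscate_sum_bound (k : F) : k != 0 -> (q - 1) * lemniscate_sum (k ^+ 2) ^+ 2 <= 4 * q ^+ 2.
Proof.
have twist (j : F) : j != 0 -> lemniscate_sum (j ^+ 2) ^+ 2 = lemniscate_sum (1 : F) ^+ 2.
  move=> j0; rewrite -[RHS]mul1r -(chi_sqr1 oddF j0) -expr2 -exprMn; congr (_ ^+ 2).
  rewrite /lemniscate_sum (reindex_inj (mulfI j0)) /= mulr_sumr; apply: eq_bigr => x _.
  by rewrite -chiM // -[RHS](chi_Msqr oddF _ j0); congr chi; ring.
move=> /twist ->; apply: le_trans (power_twist_bound _ twist) _ => //.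
have -> : \sum_(d : F) lemniscate_sum d ^+ 2 =
    q * (\sum_(x : F) \sum_(y | y ^+ 2 == x ^+ 2) chi x * chi y) :> int.
  have /= := chi_family_moment2 (@chi F) (fun x => x ^+ 2).
  rewrite sum_chi // expr0n subr0 => <-.
  apply: eq_bigr => c _; congr (_ ^+ 2); apply: eq_bigr => x _; rewrite -chiM //.
  by congr chi; ring.
have := cardz_ge0; have := @sum_fibers_le (@chi F) 2 isT.
have chi_norm x : `|chi x| <= 1 by case: (chi_cases x) => [] [] _ ->.
move=> /(_ chi_norm); nia.
Qed.

(** * Changes of the Legendre parameter and the 2-isogeny *)

Lemma legendre_sum_1B l : legendre_sum (1 - l) = chi (-1 : F) * legendre_sum l.
Proof.
rewrite /legendre_sum (reindex_inj (inv_inj (subKr 1))) mulr_sumr /=.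
by apply: eq_bigr => x _; rewrite -chiM //; congr chi; ring.
Qed.

Lemma legendre_sumV l : l != 0 -> legendre_sum l^-1 = chi l * legendre_sum l.
Proof.
move=> l0; have lV0 : l^-1 != 0 by rewrite invr_eq0.
rewrite /legendre_sum (reindex_inj (mulfI lV0)) mulr_sumr /=.
apply: eq_bigr => x _; rewrite -chiM // -[RHS](@chi_Msqr _ oddF _ (l ^- 2)) ?invr_eq0 ?expf_neq0 //.
by congr chi; field.
Qed.

(** The left sum is that of [chi (x + b / x + a)], and [x + b / x] takes the value [u]
    exactly [1 + chi (u ^ 2 - 4 b)] times. *)
Lemma isogeny_sum a b : b != 0 ->
  \sum_(x : F) chi (x * (x ^+ 2 + a * x + b)) =
  \sum_(x : F) chi (x * (x ^+ 2 - 2%:R * a * x + (a ^+ 2 - 4%:R * b))).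
Proof.
move=> b0.
have -> : \sum_(x : F) chi (x * (x ^+ 2 + a * x + b)) = \sum_(x | x != 0) chi (x + b / x + a).
  rewrite (bigD1 0) //= mul0r chi0 add0r; apply: eq_bigr => x x0.
  by rewrite -[RHS](chi_Msqr oddF _ x0); congr chi; field.
rewrite (partition_big (fun x => x + b / x) xpredT) //= [RHS](reindex_inj (addIr a)) /=.
have -> : \sum_(u : F) chi ((u + a) * ((u + a) ^+ 2 - 2%:R * a * (u + a) + (a ^+ 2 - 4%:R * b))) =
    \sum_(u : F) chi (u + a) * (1 + chi (u ^+ 2 - 4%:R * b)).
  under [RHS]eq_bigr do rewrite mulrDr mulr1; rewrite big_split /=.
  have -> : \sum_(u : F) chi (u + a) = 0 by rewrite -[RHS](sum_chi oddF) [RHS](reindex_inj (addIr a)).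
  by rewrite add0r; apply: eq_bigr => u _; rewrite -chiM //; congr chi; ring.
apply: eq_bigr => u _; rewrite -card_quadratic mulr_sumr.
rewrite (eq_bigr (fun=> chi (u + a) * 1)) => [|x /andP[_ /eqP->]]; last by rewrite mulr1.
apply: eq_bigl => x; have [->|x0] /= := eqVneq x 0.
  by rewrite expr0n mulr0 subr0 add0r (negPf b0).
rewrite -subr_eq0 -(mulrI_eq0 _ (mulfI x0)); congr (_ == 0).
by field.
Qed.

End CharacterSums.

(** * Counting nonsquare shifts *)

(** For odd q the exponent n is (q-1)/2 + 1, so cancelling a nonzero [a] leaves Euler's criterion
    for a square. *)
Lemma mpotent_chi (F : finFieldType) (a : F) :
  odd #|F| -> mpotent ((#|F| + 1) %/ 2) a -> chi a != -1.
Proof.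
move=> oddF; rewrite /mpotent (_ : (_ %/ 2)%N = #|F|.-1./2.+1); last first.
  have := finNzRing_gt1 F; have := double_half_card oddF; have -> : #|F| = #|F| :> nat by [].
  by rewrite -muln2; lia.
rewrite exprS => powa; apply/eqP => chia.
have a0 : a != 0 by apply: contra_eq_neq chia => ->; rewrite chi0.
have powa1 : a ^+ #|F|.-1./2 = 1 by apply: (mulfI a0); rewrite powa mulr1.
by have /eqP := chi_half oddF a0; rewrite powa1 chia rmorphN eq_sym (negPf (oner_neqN1 oddF)).
Qed.

(** Settles the fields whose only 4-potents are 0 and 1. The product of the [1 - chi] sums to q - 1;
    without such an [x] only x = 0 contributes, and at most 2. *)
Lemma exists_two_nonsquares (F : finFieldType) : odd #|F| -> (3 < #|F|)%N ->
  exists x : F, chi x = -1 /\ chi (x - 1) = -1.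
Proof.
move=> oddF q_gt3.
suff /existsP[x /andP[/eqP ? /eqP ?]] : [exists x : F, (chi x == -1) && (chi (x - 1) == -1)].
  by exists x.
apply: contraT; rewrite negb_exists => /forallP none.
have : \sum_(x : F) (1 - chi x) * (1 - chi (x - 1)) = cardz F - 1.
  rewrite (eq_bigr (fun x : F => 1 - chi x - chi (x - 1) + chi ((x - 0) * (x - 1)))); last first.
    by move=> x _; rewrite chiM // subr0; ring.
  rewrite big_split !sumrB /= sum_one // sum_chi // sum_chi_pair // eq_sym oner_eq0.
  have -> : \sum_(x : F) chi (x - 1) = 0.
    by rewrite -[RHS](sum_chi oddF) [RHS](reindex_inj (addIr (-1))).
  by ring.
rewrite (bigD1 0) //= big1 ?addr0 => [|x x0].
  rewrite chi0 sub0r subr0 mul1r.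
  have : 3 < cardz F by rewrite ltz_nat.
  by case: (chi_cases (-1 : F)) => [] [] _ ->; lia.
have := none x; case: (eqVneq x 1) => [->|]; first by rewrite chi1 subrr mul0r.
rewrite -subr_eq0 => x1.
by case: (chi_neq0 x0) => ->; case: (chi_neq0 x1) => ->.
Qed.

(** * The count in the presence of a primitive cube root of unity *)

Section CubeRoot.
Variable F : finFieldType.
Hypothesis oddF : odd #|F|.
Variable w : F.
Hypothesis w_eq : w ^+ 2 + w + 1 = 0.
Hypothesis three_neq0 : 3%:R != 0 :> F.
Local Notation q := (cardz F).

Lemma w2E : w ^+ 2 = - w - 1.
Proof. by apply/eqP; rewrite -subr_eq0 -w_eq; apply/eqP; ring. Qed.

Lemma w_cubed : w ^+ 3 = 1.
Proof. by rewrite exprS w2E mulrBr mulrN -expr2 w2E; ring. Qed.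

Lemma w_neq0 : w != 0.
Proof. by apply/eqP => w0; move: w_cubed; rewrite w0 expr0n => /esym/eqP; rewrite oner_eq0. Qed.

Lemma w_neq1 : w != 1.
Proof. by apply: contra_neq three_neq0 => w1; rewrite -w_eq w1; ring. Qed.

Lemma w2_neq1 : w ^+ 2 != 1.
Proof.
apply: contra_neq w_neq1 => w21.
by rewrite -[LHS]mul1r -w21 -exprSr w_cubed.
Qed.

Lemma w2_neqw : w ^+ 2 != w.
Proof. by rewrite expr2 -subr_eq0 -{3}[w]mulr1 -mulrBr mulf_neq0 ?w_neq0 // subr_eq0 w_neq1. Qed.

(** [w = w ^+ 4] is the square of [w ^+ 2]. *)
Lemma chi_w : chi w = 1.
Proof. by rewrite -[w]mul1r -w_cubed -exprSr (exprM w 2 2) chi_sqr // expf_neq0 ?w_neq0. Qed.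

Lemma chi_w2 : chi (w ^+ 2) = 1.
Proof. by rewrite chi_sqr // w_neq0. Qed.

Lemma cube_factor (x : F) : x ^+ 3 - 1 = (x - 1) * (x - w) * (x - w ^+ 2).
Proof.
rewrite (_ : _ * _ * _ = (x - 1) * (x ^+ 2 - (w ^+ 2 + w) * x + w ^+ 3)); last by ring.
by rewrite w_cubed w2E; ring.
Qed.

Lemma legendre_sum_w2 : legendre_sum (w ^+ 2) = legendre_sum w.
Proof.
have <- : w^-1 = w ^+ 2 by apply: (mulfI w_neq0); rewrite divff ?w_neq0 // -exprS w_cubed.
by rewrite legendre_sumV ?w_neq0 // chi_w mul1r.
Qed.

Lemma legendre_sum_rotate : \sum_(x : F) chi (x * (x - w) * (x - w ^+ 2)) = legendre_sum w.
Proof.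
rewrite (reindex_inj (mulfI w_neq0)) /=; apply: eq_bigr => x _; congr chi.
rewrite (_ : _ * _ * _ = w ^+ 3 * (x * (x - 1) * (x - w))); last by ring.
by rewrite w_cubed mul1r.
Qed.

(** Inverting [x] sends the root 0 to infinity and leaves a cubic; the -1 is its extra term at 0,
    where [0^-1 = 0]. *)
Lemma quartic_sum : \sum_(x : F) chi (x * (x ^+ 3 - 1)) = chi (-1 : F) * cubic_sum (1 : F) - 1.
Proof.
have -> : \sum_(x : F) chi (x * (x ^+ 3 - 1)) = \sum_(x : F | x != 0) chi (1 - (x^-1) ^+ 3).
  rewrite (bigD1 0) //= mul0r chi0 add0r; apply: eq_bigr => x x0.
  by rewrite -[RHS](chi_Msqr oddF _ (expf_neq0 2 x0)); congr chi; field.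
rewrite sum_neq0 invr0 expr0n subr0 chi1; congr (_ - _).
rewrite [LHS](reindex_inj invr_inj) /cubic_sum mulr_sumr; apply: eq_bigr => x _.
by rewrite invrK -chiM //; congr chi; ring.
Qed.

(** The sum of the products of [1 - chi (x - b)] over the four 4-potents [b], evaluated twice. The
    six pairs give -1 each; of the four triples, three give [legendre_sum w] and one gives
    [cubic_sum 1]. *)
Lemma no_nonsquare_count :
  (forall x : F, ~~ [&& chi x == -1, chi (x - 1) == -1, chi (x - w) == -1 & chi (x - w ^+ 2) == -1]) ->
  q - 6 - cubic_sum (1 : F) - 3 * legendre_sum w + (chi (-1 : F) * cubic_sum (1 : F) - 1)
  = (1 - chi (-1 : F)) ^+ 3.
Proof.
move=> none.
transitivity (\sum_(x : F) (1 - chi x) * (1 - chi (x - 1)) * (1 - chi (x - w)) * (1 - chi (x - w ^+ 2))).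
  rewrite [RHS](eq_bigr (fun x : F => 1 - chi x - chi (x - 1) - chi (x - w) - chi (x - w ^+ 2)
    + chi ((x - 0) * (x - 1)) + chi ((x - 0) * (x - w)) + chi ((x - 0) * (x - w ^+ 2))
    + chi ((x - 1) * (x - w)) + chi ((x - 1) * (x - w ^+ 2)) + chi ((x - w) * (x - w ^+ 2))
    - chi (x * (x - 1) * (x - w)) - chi (x * (x - 1) * (x - w ^+ 2)) - chi (x * (x - w) * (x - w ^+ 2))
    - chi (x ^+ 3 - 1) + chi (x * (x ^+ 3 - 1)))); last first.
    by move=> x _; rewrite cube_factor !chiM // subr0; ring.
  rewrite !(big_split, sumrN) /= sum_one // !sum_chi_pair // quartic_sum legendre_sum_rotate.
  rewrite -/(cubic_sum 1) -/(legendre_sum w) -/(legendre_sum (w ^+ 2)) legendre_sum_w2 sum_chi //.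
  have shift (a : F) : \sum_(x : F) chi (x - a) = 0.
    by rewrite -[RHS](sum_chi oddF) [RHS](reindex_inj (addIr (- a))).
  rewrite !shift ![0 == _]eq_sym oner_eq0 sqrf_eq0 (negPf w_neq0) ![1 == _]eq_sym.
  rewrite (negPf w_neq1) (negPf w2_neq1) [w == _]eq_sym (negPf w2_neqw).
  by ring.
(* Only x = 0 contributes: at 1, [w] and [w ^+ 2] the factor [1 - chi x] vanishes, and elsewhere
   [none] makes some factor vanish. *)
rewrite (bigD1 0) //= big1 ?addr0 => [|x x0].
  by rewrite !sub0r -(mulN1r w) -(mulN1r (w ^+ 2)) !chiM // chi_w chi0; ring.
case: (eqVneq x 1) => [->|]; first by rewrite chi1 subrr !mul0r.
case: (eqVneq x w) => [->|]; first by rewrite chi_w subrr !mul0r.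
case: (eqVneq x (w ^+ 2)) => [->|]; first by rewrite chi_w2 subrr !mul0r.
rewrite -!(subr_eq0 x) => x1 x2 x3; move: (none x).
case: (chi_neq0 x0) => ->; rewrite ?subrr ?mul0r //.
case: (chi_neq0 x1) => ->; rewrite ?subrr ?mulr0 ?mul0r //.
case: (chi_neq0 x2) => ->; rewrite ?subrr ?mulr0 ?mul0r //.
by case: (chi_neq0 x3) => ->; rewrite ?subrr ?mulr0 ?mul0r.
Qed.

(** The 2-isogeny turns the cubic into x (x^2 - 2 w^2 x - 3 w). Scaling [x] by -w^2 makes it -x (x -
    1)(x + 3), of parameter -3 = 1 - 4. *)
Lemma legendre_sum_w_4 : legendre_sum w = legendre_sum (4%:R : F).
Proof.
have chiN1 : chi (-1 : F) * chi (-1 : F) = 1 by rewrite -chiM // mulrNN mulr1 chi1.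
rewrite -[RHS]mul1r -chiN1 -mulrA -legendre_sum_1B //.
rewrite /legendre_sum (eq_bigr (fun x => chi (x * (x ^+ 2 + w ^+ 2 * x + w)))); last first.
  by move=> x _; rewrite w2E; congr chi; ring.
rewrite isogeny_sum ?w_neq0 // mulr_sumr.
have u0 : - w ^+ 2 != 0 by rewrite oppr_eq0 expf_neq0 ?w_neq0.
rewrite (reindex_inj (mulfI u0)) /=; apply: eq_bigr => x _; rewrite -chiM //; congr chi.
rewrite (_ : - w ^+ 2 * x * _ = - (w ^+ 3) * x * (w ^+ 3 * x ^+ 2 + 2%:R * w ^+ 3 * x
  + w ^+ 3 - 4%:R)); last by ring.
by rewrite w_cubed; ring.
Qed.

End CubeRoot.

(** * Coincidences in the Legendre family *)

Definition anharmonic (K : fieldType) (l : K) : seq K :=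
  [:: l; l^-1; 1 - l; (1 - l)^-1; 1 - l^-1; (1 - l^-1)^-1].

(** The pair stands for the Eisenstein integer a + b w; the form is nonnegative, so the absolute
    value only changes the type. *)
Definition eisenstein_norm (u : int * int) : nat := absz (u.1 ^+ 2 - u.1 * u.2 + u.2 ^+ 2).

(** A test over the integers that keeps the two points distinct in every characteristic outside [ps]
    at once. *)
Definition separated (ps : seq nat) (u v : int * int) : bool :=
  let N := eisenstein_norm (u.1 - v.1, u.2 - v.2) in
  (0 < N)%N && all (fun r => r \in ps) (primes N).

Section LegendreFamily.
Variable F : finFieldType.
Hypothesis oddF : odd #|F|.
Implicit Types l m : F.
Local Notation q := (cardz F).

Lemma chiN1_sqr : chi (-1 : F) ^+ 2 = 1.
Proof. by rewrite expr2 -chiM // mulrNN mulr1 chi1. Qed.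

Lemma legendre_sum_1B_sqr l : legendre_sum (1 - l) ^+ 2 = legendre_sum l ^+ 2.
Proof. by rewrite legendre_sum_1B // exprMn chiN1_sqr mul1r. Qed.

Lemma legendre_sumV_sqr l : legendre_sum l^-1 ^+ 2 = legendre_sum l ^+ 2.
Proof.
have [->|l0] := eqVneq l 0; first by rewrite invr0.
by rewrite legendre_sumV // exprMn expr2 chi_sqr1 // mul1r.
Qed.

Lemma legendre_sum_anharmonic l m :
  m \in anharmonic l -> legendre_sum m ^+ 2 = legendre_sum l ^+ 2.
Proof.
rewrite !inE; do !case/orP; move=> /eqP ->.
all: by rewrite ?legendre_sumV_sqr ?legendre_sum_1B_sqr ?legendre_sumV_sqr ?legendre_sum_1B_sqr
  ?legendre_sumV_sqr.
Qed.

(** The points of [s] contribute [size s] copies of [u] to the second moment, whose other terms are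
    nonnegative. *)
Lemma legendre_sum_repeated (s : seq F) (u : int) : uniq s ->
  (forall m, m \in s -> legendre_sum m ^+ 2 = u) -> (size s)%:Z * u <= q ^+ 2 - 2 * q - 1.
Proof.
move=> uniq_s all_s; rewrite -(legendre_moment2 oddF).
have -> : (size s)%:Z * u = \sum_(m in s) legendre_sum m ^+ 2.
  rewrite (eq_bigr (fun=> u)) => [|m]; last exact: all_s.
  by rewrite sumr_const (card_uniqP uniq_s) -mulr_natl natz.
by rewrite big_mkcond; apply: ler_sum => m _; case: ifP => // _; rewrite sqr_ge0.
Qed.

(** The 2-isogeny sends x (x^2 - 5x + 4) to x (x + 1)(x + 9); then negate [x]. *)
Lemma legendre_sum_4_9 : legendre_sum (4%:R : F) = chi (-1 : F) * legendre_sum (9%:R : F).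
Proof.
have four0 : 4%:R != 0 :> F by rewrite -[4%N]/(2 * 2)%N natrM mulf_neq0 ?natr2_neq0.
rewrite /legendre_sum.
rewrite (eq_bigr (fun x : F => chi (x * (x ^+ 2 + (- 5%:R) * x + 4%:R)))); last first.
  by move=> x _; congr chi; ring.
rewrite isogeny_sum // (reindex_inj oppr_inj) mulr_sumr /=; apply: eq_bigr => x _.
by rewrite -chiM //; congr chi; ring.
Qed.

(** Reduces an identity valid modulo [n] to one that [ring] proves, given the cofactor [c]. *)
Lemma eq_modulo (n : nat) (a b c : F) : n%:R = 0 :> F -> a = b + n%:R * c -> a = b.
Proof. by move=> -> ->; rewrite mul0r addr0. Qed.

Lemma legendre_sum_4_char5 : 5%:R = 0 :> F ->
  legendre_sum (4%:R : F) = lemniscate_sum (1 ^+ 2 : F).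
Proof.
move=> F5; apply: eq_bigr => x _; congr chi.
by apply: (eq_modulo (c := x - x ^+ 2) F5); ring.
Qed.

(** The roots 1, 4, 7 = 0 form an arithmetic progression of step 3; the shift by 4 centres it. *)
Lemma legendre_sum_4_char7 : 7%:R = 0 :> F ->
  legendre_sum (4%:R : F) = lemniscate_sum (3%:R ^+ 2 : F).
Proof.
move=> F7; rewrite /legendre_sum (reindex_inj (addIr (4%:R : F))) /=; apply: eq_bigr => x _; congr chi.
by apply: (eq_modulo (c := x ^+ 2 + 3%:R * x) F7); ring.
Qed.

(** Here 4^2 - 4 + 1 = 0, so the j-invariant is 0; the shift by 6, the mean of the roots 0, 1, 4,
    exposes the pure cubic. *)
Lemma legendre_sum_4_char13 : 13%:R = 0 :> F ->
  legendre_sum (4%:R : F) = cubic_sum ((- 2%:R) ^+ 3 : F).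
Proof.
move=> F13; rewrite /legendre_sum (reindex_inj (addIr (6%:R : F))) /=; apply: eq_bigr => x _; congr chi.
by apply: (eq_modulo (c := x ^+ 2 + 4%:R * x + 4%:R) F13); ring.
Qed.

Lemma lemniscate_sum_eq0 (d : F) : chi (-1 : F) = -1 -> lemniscate_sum d = 0.
Proof.
move=> chiN1; have : lemniscate_sum d = chi (-1 : F) * lemniscate_sum d; last by rewrite chiN1; lia.
rewrite {1}/lemniscate_sum (reindex_inj oppr_inj) mulr_sumr /=; apply: eq_bigr => x _.
by rewrite -chiM //; congr chi; ring.
Qed.

Lemma chiN1_eq1 (n m : nat) : (n ^ 2).+1 = m -> m%:R = 0 :> F -> chi (-1 : F) = 1.
Proof.
move=> <- m0; have -> : -1 = n%:R ^+ 2 :> F.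
  by apply/esym/eqP; rewrite -subr_eq0 opprK -natrX -(natrD _ _ 1) addn1 m0.
apply: chi_sqr => //; apply: contra_eq_neq m0 => n0.
by rewrite -addn1 natrD natrX n0 expr0n add0r oner_eq0.
Qed.

(** * Distinctness of the parameters in characteristic p *)

Section Distinct.
Variable w : F.
Hypothesis w_eq : w ^+ 2 + w + 1 = 0.
Hypothesis three_neq0 : 3%:R != 0 :> F.
Variables (p : nat) (p_pr : prime p) (charFp : p \in [pchar F]).

Definition eisenstein (u : int * int) : F := u.1%:~R + u.2%:~R * w.

(** The norm is the product of a + b w with its conjugate a + b w^2, where w^2 = -w - 1; a zero
    factor would make [p] divide it. *)
Lemma eisenstein_neq0 u : ~~ (p %| eisenstein_norm u)%N -> eisenstein u != 0.
Proof.
apply: contra => /eqP u0; rewrite (dvdn_pcharf charFp).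
have : (eisenstein_norm u)%:Z%:~R = 0 :> F.
  rewrite /eisenstein_norm abszE ger0_norm; last by case: (u) => a b /=; nia.
  transitivity (eisenstein u * (u.1%:~R + u.2%:~R * (- w - 1))); last by rewrite u0 mul0r.
  rewrite -(w2E w_eq) /eisenstein !(rmorphD, rmorphN, rmorphM, rmorphXn) /=.
  rewrite [RHS](_ : _ = u.1%:~R ^+ 2 + u.1%:~R * u.2%:~R * (w ^+ 2 + w)
    + u.2%:~R ^+ 2 * w ^+ 3); last by ring.
  by rewrite w_cubed // w2E //; ring.
by move/eqP.
Qed.

(** The factor [c] clears denominators; distinct multiples come from distinct elements. *)
Lemma separated_uniq (ps : seq nat) (c : F) (s : seq F) L : p \notin ps ->
  [seq c * x | x <- s] = [seq eisenstein u | u <- L] -> pairwise (separated ps) L -> uniq s.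
Proof.
move=> p_ps eq_sL sepL; apply: (map_uniq (f := fun x => c * x)); rewrite eq_sL.
rewrite uniq_pairwise pairwise_map; apply: sub_pairwise sepL => u v /andP[N0 /allP primesN] /=.
rewrite -subr_eq0 (_ : _ - _ = eisenstein (u.1 - v.1, u.2 - v.2)); last first.
  by rewrite /eisenstein /= !rmorphB /=; ring.
apply: eisenstein_neq0; apply: contra p_ps => pN.
by apply: primesN; rewrite mem_primes p_pr N0.
Qed.

Lemma mul_invf (c x y : F) : x != 0 -> c = y * x -> c / x = y.
Proof. by move=> x0 ->; rewrite mulfK. Qed.

(** Since 1 - w and 1 - w^2 have norm 3, their inverses have denominator 3, hence the form of
    [n]. *)
Lemma scaled_anharmonic_w (n : nat) (m : int) : n%:Z = 3 * m ->
  [seq n%:R * x | x <- anharmonic w] = [seq eisenstein u | u <-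
    [:: (0, n%:Z); (- n%:Z, - n%:Z); (n%:Z, - n%:Z); (2 * m, m); (2 * n%:Z, n%:Z); (m, - m)]].
Proof.
move=> nE; have w0 := w_neq0 w_eq; have w1 := w_neq1 w_eq three_neq0; have w2 := w2_neq1 w_eq three_neq0.
have -> : n%:R = 3%:R * m%:~R :> F by rewrite -[n%:R]/(n%:Z%:~R) nE rmorphM.
rewrite nE /eisenstein /= (_ : w^-1 = w ^+ 2); last first.
  by apply: (mulfI w0); rewrite divff // -exprS w_cubed.
congr [:: _; _; _; _; _; _]; rewrite ?rmorphN ?rmorphM ?rmorph0 /=.
- by ring.
- by rewrite w2E //; ring.
- by ring.
- apply: mul_invf; first by rewrite subr_eq0 eq_sym.
  rewrite (_ : _ * (1 - w) = m%:~R * (2%:R - w - w ^+ 2)); last by ring.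
  by rewrite w2E //; ring.
- by rewrite w2E //; ring.
- apply: mul_invf; first by rewrite subr_eq0 eq_sym.
  rewrite (_ : _ * (1 - w ^+ 2) = m%:~R * (1 - w - w ^+ 2 + w ^+ 3)); last by ring.
  by rewrite w_cubed // w2E //; ring.
Qed.

(** In the two bounds below, the integer pairs are the coordinates on [(1, w)] of the twelve
    (ten) points multiplied by 12 (by 9); the excluded primes are those dividing the norm
    of some difference. *)
Lemma legendre_sum_w_bound12 : p \notin [:: 2; 3; 5; 7; 13; 37]%N ->
  12 * legendre_sum w ^+ 2 <= q ^+ 2 - 2 * q - 1.
Proof.
move=> p_good.
have two0 := natr2_neq0 oddF.
have four0 : 4%:R != 0 :> F by rewrite -[4%N]/(2 * 2)%N natrM mulf_neq0.
have four1 : 1 - 4%:R != 0 :> F by rewrite (_ : _ - _ = - 3%:R) ?oppr_eq0 //; ring.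
apply: (@legendre_sum_repeated (anharmonic w ++ anharmonic 4%:R)) => [|m]; last first.
  rewrite mem_cat => /orP[] /legendre_sum_anharmonic -> //.
  by rewrite (legendre_sum_w_4 oddF w_eq).
apply: (@separated_uniq _ 12%:R _
  ([:: (0, 12); (-12, -12); (12, -12); (8, 4); (24, 12); (4, -4)] ++
   [:: (48, 0); (3, 0); (-36, 0); (-4, 0); (9, 0); (16, 0)]) p_good); last by vm_compute.
rewrite !map_cat; congr (_ ++ _); first exact: (@scaled_anharmonic_w 12 4).
rewrite /eisenstein /=; congr [:: _; _; _; _; _; _]; try by field.
- by field; rewrite oppr_eq0.
- by field; rewrite four0.
Qed.

Lemma legendre_sum_w_bound10 : p = 37%N ->
  10 * legendre_sum w ^+ 2 <= q ^+ 2 - 2 * q - 1.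
Proof.
move=> p37; have nine0 : 9%:R != 0 :> F by rewrite -[9%N]/(3 * 3)%N natrM mulf_neq0.
apply: (@legendre_sum_repeated (anharmonic w ++ [:: 9%:R; 9%:R^-1; 1 - 9%:R; 1 - 9%:R^-1]))
  => [|m]; last first.
  rewrite mem_cat => /orP[/legendre_sum_anharmonic -> //|m9].
  have /legendre_sum_anharmonic -> : m \in anharmonic (9%:R : F).
    by move: m9; rewrite !inE; do !case/orP; move=> ->; rewrite ?orbT.
  by rewrite (legendre_sum_w_4 oddF w_eq) legendre_sum_4_9 exprMn chiN1_sqr mul1r.
apply: (@separated_uniq [:: 2; 3; 5; 7; 13; 17; 19; 31; 73]%N 9%:R _
  ([:: (0, 9); (-9, -9); (9, -9); (6, 3); (18, 9); (3, -3)] ++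
   [:: (81, 0); (1, 0); (-72, 0); (8, 0)])); [by rewrite p37 | | by vm_compute].
rewrite !map_cat; congr (_ ++ _); first exact: (@scaled_anharmonic_w 9 3).
by rewrite /eisenstein /=; congr [:: _; _; _; _]; field.
Qed.

End Distinct.
End LegendreFamily.

(** * Small prime fields *)

Module BN := BinNat.N.

(** Square-and-multiply on binary numbers, to make the search feasible for [vm_compute]. *)
Fixpoint powmod (n a : BinNums.N) (k : BinNums.positive) : BinNums.N :=
  match k with
  | BinNums.xH => BN.modulo a n
  | BinNums.xO k' => powmod n (BN.modulo (BN.mul a a) n) k'
  | BinNums.xI k' => BN.modulo (BN.mul a (powmod n (BN.modulo (BN.mul a a) n) k')) n
  end.

(** Euler's criterion, with [BN.pred N] for -1; adding [N] first keeps the truncated subtraction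
    exact for [b] up to [N]. *)
Definition nonsquare_shifts (n : nat) (bs : seq BinNums.N) (g : BinNums.N) : bool :=
  let N := BN.of_nat n in
  all (fun b => BN.eqb (powmod N (BN.sub (BN.add g N) b) (BinPos.Pos.of_nat n.-1./2)) (BN.pred N)) bs.

Definition potents4 (n : nat) : seq BinNums.N :=
  let N := BN.of_nat n in
  [seq b <- map BN.of_nat (iota 0 n) | BN.eqb (BN.modulo (BN.mul (BN.mul b b) (BN.mul b b)) N) b].

(** Junk value: [100] when no [k < 100] works. *)
Definition find_shift (n : nat) : nat :=
  let bs := potents4 n in find (fun k => nonsquare_shifts n bs (BN.of_nat k)) (iota 0 100).

Lemma small_primes_shifts n : (124 < n < 1700)%N -> (n %% 4 = 3)%N -> prime n ->
  exists g, nonsquare_shifts n (potents4 n) g.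
Proof.
(* The interval runs from 125 to 1699. *)
have : all (fun n => if (n %% 4 == 3)%N && prime n
    then (find_shift n < 100)%N
    else true) (iota 125 1575).
  by vm_compute.
move=> /allP check n_range n4 n_pr.
have /check : n \in iota 125 1575 by rewrite mem_iota; move: n_range; lia.
rewrite n4 n_pr /= /find_shift => found.
have /hasP[k _ ?] : has (fun k => nonsquare_shifts n (potents4 n) (BN.of_nat k)) (iota 0 100).
  by rewrite has_find size_iota.
by exists (BN.of_nat k).
Qed.

(** * Transfer of the search to the prime field *)

Section PrimeField.
Variable F : finFieldType.
Hypothesis oddF : odd #|F|.
Variables (n : nat) (cardF : #|F| = n) (n_pr : prime n).

Definition Nval (a : BinNums.N) : F := (BN.to_nat a)%:R.

Lemma charFn : n \in [pchar F].
Proof. by apply: (@card_finPcharP _ n 1); rewrite ?expn1. Qed.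

Lemma NvalM a b : Nval (BN.mul a b) = Nval a * Nval b.
Proof. by rewrite /Nval Nnat.N2Nat.inj_mul natrM. Qed.

Lemma NvalD a b : Nval (BN.add a b) = Nval a + Nval b.
Proof. by rewrite /Nval Nnat.N2Nat.inj_add natrD. Qed.

Lemma Nval_of_nat k : Nval (BN.of_nat k) = k%:R.
Proof. by rewrite /Nval Nnat.Nat2N.id. Qed.

Lemma Nval_mod a : Nval (BN.modulo a (BN.of_nat n)) = Nval a.
Proof.
rewrite [in RHS](BN.div_mod' a (BN.of_nat n)) NvalD NvalM Nval_of_nat.
by rewrite (pcharf0 charFn) mul0r add0r.
Qed.

Lemma Nval_powmod a k : Nval (powmod (BN.of_nat n) a k) = Nval a ^+ BinPos.Pos.to_nat k.
Proof.
elim: k a => [k IHk|k IHk|] a /=; last by rewrite Nval_mod expr1.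
  by rewrite Nval_mod NvalM IHk Nval_mod NvalM Pnat.Pos2Nat.inj_xI -expr2 -exprM -exprS.
by rewrite IHk Nval_mod NvalM Pnat.Pos2Nat.inj_xO -expr2 -exprM.
Qed.

Lemma natr_inj_lt i j : (i < n)%N -> (j < n)%N -> i%:R = j%:R :> F -> i = j.
Proof.
wlog le_ij : i j / (i <= j)%N.
  by move=> IH i_n j_n ij; case/orP: (leq_total i j) => le; [|apply/esym]; apply: IH.
move=> _ j_n ij; have : (n %| j - i)%N by rewrite (dvdn_pcharf charFn) natrB // ij subrr.
by move=> /dvdn_leq; rewrite subn_gt0; lia.
Qed.

Lemma natr_surj (b : F) : exists2 k, (k < n)%N & b = k%:R.
Proof.
have inj_natr : injective (fun i : 'I_n => (i : nat)%:R : F).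
  by move=> i j /natr_inj_lt ij; apply/val_inj/ij.
have /codomP[i ->] : b \in codom (fun i : 'I_n => (i : nat)%:R : F).
  by apply: inj_card_onto; rewrite ?card_ord ?cardF.
by exists i.
Qed.

Lemma nonsquare_shiftsP g (b : F) :
  nonsquare_shifts n (potents4 n) g -> b ^+ 4 = b -> chi (Nval g - b) = -1.
Proof.
have n_gt1 := prime_gt1 n_pr; have n0 := pcharf0 charFn.
have odd_n : odd n by rewrite -cardF.
have [k k_n ->] := natr_surj b; move=> /allP /(_ (BN.of_nat k)) + k4.
have -> : BN.of_nat k \in potents4 n.
  rewrite mem_filter map_f ?mem_iota // andbT; apply/BN.eqb_spec/Nnat.N2Nat.inj.
  apply: natr_inj_lt; rewrite ?Nnat.Nat2N.id //.
    rewrite Nnat.N2Nat.inj_mod Nnat.Nat2N.id.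
    by apply/ssrnat.ltP/PeanoNat.Nat.mod_upper_bound => n_eq0; rewrite n_eq0 in n_gt1.
  rewrite -[LHS]/(Nval _) Nval_mod !NvalM Nval_of_nat -[RHS]k4; ring.
move=> /(_ isT)/BN.eqb_spec /(congr1 Nval).
rewrite Nval_powmod Pnat.Nat2Pos.id; last by move: odd_n n_gt1; clear; lia.
have -> : Nval (BN.sub (BN.add g (BN.of_nat n)) (BN.of_nat k)) = Nval g - k%:R.
  rewrite /Nval Nnat.N2Nat.inj_sub Nnat.N2Nat.inj_add !Nnat.Nat2N.id.
  rewrite natrB; last by rewrite (leq_trans (ltnW k_n)) // leq_addl.
  by rewrite natrD n0 addr0.
have -> : Nval (BN.pred (BN.of_nat n)) = -1.
  rewrite /Nval Nnat.N2Nat.inj_pred Nnat.Nat2N.id; apply/eqP; rewrite -subr_eq0 opprK.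
  by rewrite -(natrD _ _ 1) addn1 (ltn_predK n_gt1) n0.
move=> pow_half; have half_gt0 : (0 < n.-1./2)%N by move: odd_n n_gt1; clear; lia.
have a0 : Nval g - k%:R != 0.
  apply: contra_eq_neq pow_half => ->; rewrite expr0n eqn0Ngt half_gt0 eq_sym oppr_eq0.
  exact: oner_neq0.
have := chi_half oddF a0; rewrite cardF pow_half; case: (chi_neq0 a0) => -> // /eqP.
by rewrite (negPf (oner_neqN1 oddF)).
Qed.

End PrimeField.

(** * Conclusion *)

(** The bound amounts to q^2 - 122 q + 499 <= 0, which fails from q = 118 on. *)
Lemma second_moment_contra (q U : int) : 124 < q -> 3 * U = q - 7 ->
  10 * U ^+ 2 <= q ^+ 2 - 2 * q - 1 -> False.
Proof. by nia. Qed.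

Lemma twist_contra (q U : int) : 124 < q -> 3 * U = q - 7 -> (q - 1) * U ^+ 2 <= 6 * q ^+ 2 -> False.
Proof.
move=> q_gt U_eq bound.
have : (q - 1) * (q - 7) ^+ 2 <= 54 * q ^+ 2 by rewrite -U_eq; nia.
by nia.
Qed.

Lemma cubic_contra (q T : int) : 124 < q -> 2 * T = q - 15 -> (q - 1) * T ^+ 2 <= 6 * q ^+ 2 -> False.
Proof.
move=> q_gt T_eq bound.
have : (q - 1) * (q - 15) ^+ 2 <= 24 * q ^+ 2 by rewrite -T_eq; nia.
by nia.
Qed.

(** For q >= 1700, T is about sqrt(6q) at most, hence below 0.0665 q - 7.5. Then U >= 0.289 q, and
    12 * 0.289^2 > 1. *)
Lemma moments_small (q T U : int) : 3 * U = q - 15 - 2 * T ->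
  (q - 1) * T ^+ 2 <= 6 * q ^+ 2 -> 12 * U ^+ 2 <= q ^+ 2 - 2 * q - 1 -> q < 1700.
Proof.
move=> U_eq T_bound U_bound; rewrite ltNge; apply/negP => q_ge.
have T_small : T ^+ 2 <= 6 * q + 7 by nia.
have T_le : 2000 * T <= 133 * q - 15000 by nia.
have U_ge : 867 * q <= 3000 * U by lia.
by nia.
Qed.

(** Here p >= 11. Squares are never 3 mod 4; a cube below 1700 < 12^3 must be 11^3, which is 2 mod
    3; and 11^4 is too large. *)
Lemma prime_power_prime (p k : nat) : prime p -> p \notin [:: 2; 3; 5; 7; 13; 37]%N ->
  (p ^ k %% 3 = 1)%N -> (p ^ k %% 4 = 3)%N -> (p ^ k < 1700)%N -> prime (p ^ k).
Proof.
move=> p_pr p_good.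
have p_ge11 : (11 <= p)%N by case: p p_pr p_good => [|[|[|[|[|[|[|[|[|[|[|p]]]]]]]]]]].
case: k => [|[|[|[|k]]]]; rewrite ?expn0 ?expn1 //.
- move=> _; rewrite -modnXm; have := ltn_pmod p (isT : 0 < 4)%N.
  by case: (p %% 4)%N => [|[|[|[|]]]].
- move=> mod3 _ p3_lt; have p_le11 : (p <= 11)%N.
    by rewrite -ltnS -(ltn_exp2r _ _ (isT : 0 < 3)%N) (leq_trans p3_lt).
  by move: mod3; have -> : p = 11%N by apply/eqP; rewrite eqn_leq p_le11.
move=> _ _; rewrite ltnNge => /negP[]; apply: leq_trans (_ : p ^ 4 <= _)%N.
  by apply: leq_trans (_ : 11 ^ 4 <= _)%N; rewrite ?leq_exp2r.
by rewrite leq_pexp2l // (leq_trans _ p_ge11).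
Qed.

(** * Constraints on a counterexample *)

Section Conclusion.
Variable F : finFieldType.
Hypothesis oddF : odd #|F|.
Variable w : F.
Hypothesis w_eq : w ^+ 2 + w + 1 = 0.
Hypothesis three_neq0 : 3%:R != 0 :> F.
Hypothesis none : forall x : F,
  ~~ [&& chi x == -1, chi (x - 1) == -1, chi (x - w) == -1 & chi (x - w ^+ 2) == -1].
Hypothesis q_gt124 : 124 < cardz F.
Variables (p : nat) (p_pr : prime p) (charFp : p \in [pchar F]).
Local Notation q := (cardz F).

(** If -1 were a square, the two terms in [cubic_sum 1] would cancel in the count and leave 3 S(w) =
    q - 7, too large for the bound available in each characteristic. *)
Lemma chiN1_neq1 : chi (-1 : F) != 1.
Proof.
apply/eqP => chiN1.
have U_eq : 3 * legendre_sum w = q - 7.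
  by have := no_nonsquare_count oddF w_eq three_neq0 none; rewrite chiN1; lia.
have U_w4 := legendre_sum_w_4 oddF w_eq.
have p0 : p%:R = 0 :> F := pcharf0 charFp.
have two0 := natr2_neq0 oddF.
have [p_bad|p_good] := boolP (p \in [:: 2; 3; 5; 7; 13; 37]%N); last first.
  have := legendre_sum_w_bound12 oddF w_eq three_neq0 p_pr charFp p_good => U_bound.
  apply: (second_moment_contra q_gt124 U_eq); apply: le_trans U_bound.
  by rewrite ler_wpM2r ?sqr_ge0.
move: p_bad p0; rewrite !inE; do !case/orP; move=> /eqP p_eq; rewrite p_eq => p0.
- by rewrite p0 eqxx in two0.
- by move: three_neq0; rewrite p0 eqxx.
- have := lemniscate_sum_bound oddF (oner_neq0 F); rewrite -legendre_sum_4_char5 // -U_w4 => U_bound.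
  apply: (twist_contra q_gt124 U_eq); apply: le_trans U_bound _.
  by rewrite ler_wpM2r ?sqr_ge0.
- have := lemniscate_sum_bound oddF three_neq0; rewrite -legendre_sum_4_char7 // -U_w4 => U_bound.
  apply: (twist_contra q_gt124 U_eq); apply: le_trans U_bound _.
  by rewrite ler_wpM2r ?sqr_ge0.
- have mtwo0 : - 2%:R != 0 :> F by rewrite oppr_eq0.
  have := cubic_sum_bound oddF mtwo0; rewrite -legendre_sum_4_char13 // -U_w4.
  exact: twist_contra.
- have := legendre_sum_w_bound10 oddF w_eq three_neq0 p_pr charFp p_eq.
  exact: second_moment_contra.
Qed.

Lemma chiN1_eqN1 : chi (-1 : F) = -1.
Proof.
have N10 : -1 != 0 :> F by rewrite oppr_eq0 oner_neq0.
by case: (chi_neq0 N10) => // /eqP; rewrite (negPf chiN1_neq1).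
Qed.

(** Modulo 5, 13 and 37, -1 is the square of 2, 5 and 6. In characteristic 7, S(w) is a lemniscate
    sum, zero by oddness, so [cubic_sum 1] would be (q - 15)/2, against its bound. *)
Lemma no_shift_characteristic : p \notin [:: 2; 3; 5; 7; 13; 37]%N.
Proof.
apply/negP; have p0 : p%:R = 0 :> F := pcharf0 charFp.
have two0 := natr2_neq0 oddF; have chiN1 := chiN1_eqN1.
rewrite !inE; do !case/orP; move=> /eqP p_eq; rewrite p_eq in p0.
- by rewrite p0 eqxx in two0.
- by move: three_neq0; rewrite p0 eqxx.
- by move: chiN1; rewrite (@chiN1_eq1 _ oddF 2 5).
- have := no_nonsquare_count oddF w_eq three_neq0 none.
  rewrite (legendre_sum_w_4 oddF w_eq) legendre_sum_4_char7 // lemniscate_sum_eq0 // chiN1.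
  have := cubic_sum_bound oddF (oner_neq0 F); rewrite expr1n => T_bound T_eq.
  by apply: cubic_contra q_gt124 _ T_bound; lia.
- by move: chiN1; rewrite (@chiN1_eq1 _ oddF 5 26) // -[26%N]/(2 * 13)%N natrM p0 mulr0.
- by move: chiN1; rewrite (@chiN1_eq1 _ oddF 6 37).
Qed.

Lemma no_shift_small : q < 1700.
Proof.
have U_bound := legendre_sum_w_bound12 oddF w_eq three_neq0 p_pr charFp no_shift_characteristic.
have := no_nonsquare_count oddF w_eq three_neq0 none; rewrite chiN1_eqN1 => count.
have := cubic_sum_bound oddF (oner_neq0 F); rewrite expr1n => T_bound.
by apply: moments_small T_bound U_bound; lia.
Qed.

Lemma card_mod4 : (#|F| %% 4 = 3)%N.
Proof.
have N10 : -1 != 0 :> F by rewrite oppr_eq0 oner_neq0.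
have := chi_half oddF N10; rewrite chiN1_eqN1 rmorphN1 -signr_odd.
have := double_half_card oddF; rewrite -muln2; case odd_half: (odd _) => dbl; last first.
  by move/eqP; rewrite expr0 eq_sym (negPf (oner_neqN1 oddF)).
by move=> _; move: oddF dbl odd_half; generalize #|F| => n; lia.
Qed.

(** [w] has order 3 and satisfies w^q = w. *)
Lemma card_mod3 : (#|F| %% 3 = 1)%N.
Proof.
have : w ^+ (#|F| %% 3) = w by rewrite expr_mod ?w_cubed // expf_card.
have := ltn_pmod #|F| (isT : 0 < 3)%N; case: (_ %% 3)%N => [|[|[|//]]] _ // /eqP.
  by rewrite eq_sym (negPf (w_neq1 w_eq three_neq0)).
by rewrite (negPf (w2_neqw w_eq three_neq0)).
Qed.

Lemma card_prime : prime #|F|.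
Proof.
have cardF := card_pprimeChar charFp.
have := no_shift_small; rewrite ltz_nat; have := card_mod4; have := card_mod3.
by rewrite cardF; apply: prime_power_prime no_shift_characteristic.
Qed.

End Conclusion.

Lemma pot4_cases (K : fieldType) (b : K) : b ^+ 4 = b -> [\/ b = 0, b = 1 | b ^+ 2 + b + 1 = 0].
Proof.
move=> /eqP; rewrite -subr_eq0 (_ : _ - _ = b * (b - 1) * (b ^+ 2 + b + 1)); last by ring.
rewrite !mulf_eq0 subr_eq0 => /orP[/orP[]|] /eqP; by [constructor 1 | constructor 2 | constructor 3].
Qed.

Lemma exists_nonsquare_shifts (F : finFieldType) : odd #|F| -> (124 < #|F|)%N ->
  exists x : F, forall b, b ^+ 4 = b -> chi (x - b) = -1.
Proof.
move=> oddF q_gt.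
have [/andP[three_neq0 /existsP[w /eqP w_eq]]|no_w] :=
  boolP ((3%:R != 0 :> F) && [exists w : F, w ^+ 2 + w + 1 == 0]); last first.
  have [|x [x0 x1]] := exists_two_nonsquares oddF; first exact: leq_trans q_gt.
  exists x => b /pot4_cases[->|->//|b_eq]; first by rewrite subr0.
  suff -> : b = 1 by [].
  move: no_w; rewrite negb_and negbK => /orP[/eqP F3|/existsP[]]; last by exists b; apply/eqP.
  (* In characteristic 3, b^2 + b + 1 = (b - 1)^2. *)
  apply/eqP; rewrite -subr_eq0 -sqrf_eq0; apply/eqP.
  by apply: (eq_modulo (c := - b) F3); rewrite -b_eq; ring.
have [/existsP[x /and4P[/eqP x0 /eqP x1 /eqP xw /eqP xw2]]|/existsPn none] :=
    boolP [exists x : F, [&& chi x == -1, chi (x - 1) == -1, chi (x - w) == -1 & chi (x - w ^+ 2) == -1]].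
  exists x => b /pot4_cases[->|->//|b_eq]; first by rewrite subr0.
  have : (b - w) * (b - w ^+ 2) = 0.
    rewrite (_ : _ * _ = b ^+ 2 - (w ^+ 2 + w) * b + w ^+ 3); last by ring.
    by rewrite (w_cubed w_eq) (w2E w_eq) -[RHS]b_eq; ring.
  by move/eqP; rewrite mulf_eq0 !subr_eq0 => /orP[] /eqP ->.
(* A counterexample would be a prime field with q < 1700 and q = 3 mod 4, where the search supplies
   a shift. *)
have [p p_pr charFp] := finPcharP F.
have q_gt124 : 124 < cardz F by rewrite ltz_nat.
have q_pr := card_prime oddF w_eq three_neq0 none q_gt124 p_pr charFp.
have q_small := no_shift_small oddF w_eq three_neq0 none q_gt124 p_pr charFp.
have q_mod4 := card_mod4 oddF w_eq three_neq0 none q_gt124 p_pr charFp.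
have [|g shifts] := @small_primes_shifts #|F| _ q_mod4 q_pr.
  by rewrite q_gt -ltz_nat.
by exists (Nval F g) => b; apply: nonsquare_shiftsP shifts.
Qed.

Theorem theorem2p2 (F : finFieldType) :
  odd #|F| -> (124 < #|F|)%N ->
  exists gamma : F, ~ (exists alpha beta : F,
    gamma = alpha + beta /\ mpotent ((#|F| + 1) %/ 2) alpha /\ mpotent 4 beta).
Proof.
move=> oddF q_gt; have [x shifts] := exists_nonsquare_shifts oddF q_gt.
exists x => -[alpha [beta [xE [alpha_n beta_4]]]].
(* [alpha = x - beta] would be a nonsquare, which no n-potent is. *)
have := mpotent_chi oddF alpha_n.
by rewrite (_ : alpha = x - beta) ?shifts // xE addrK.
Qed.
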